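(* The model structure on $\mathbf{DblCat}$ induced by the simplicially surjective topology $\tau$ on $\mathbf{Cat}$ (with weak equivalences the $\tau$-equivalences, fibrations the $\tau$-fibrations and cofibrations the $\tau$-cofibrations) coincides with the model structure obtained by transferring the diagram categorical structure on $\mathbf{Cat}^{\Delta^{op}}$ across the vertical categorification–vertical nerve adjunction $c_v\dashv N_v$, i.e. with the model structure in which a double functor $K$ is a weak equivalence (respectively fibration) if and only if for every $k\ge 0$ the functor $(N_vK)_k$ is an equivalence of categories (respectively an isofibration).
   Context: $\mathbf{DblCat}$ is the category of internal categories in $\mathbf{Cat}$ (small double categories) and internal functors (double functors). A double category $\mathbb{B}$ has a category $\mathbb{B}_0$ of objects and vertical morphisms and a category $\mathbb{B}_1$ of horizontal morphisms and squares (composed vertically), with horizontal source and target functors $s,t:\mathbb{B}_1\to\mathbb{B}_0$. Vertical nerve: $N_v\mathbb{B}\in\mathbf{Cat}^{\Delta^{op}}$; the category $(N_v\mathbb{B})_k$ has as objects the composable strings of $k$ vertical morphisms of $\mathbb{B}$ (objects of $\mathbb B$ if $k=0$) and as morphisms the vertically composable strings of $k$ squares (horizontal morphisms if $k=0$), with horizontal composition. $c_v$ is the left adjoint of $N_v$. The diagram categorical structure on $\mathbf{Cat}^{\Delta^{op}}$ has levelwise equivalences of categories as weak equivalences and levelwise isofibrations as fibrations (an isofibration $F:\mathbf{A}\to\mathbf{B}$ is a functor such that every isomorphism $b\cong Fa$ lifts to an isomorphism $a'\cong a$). Its transfer along $c_v\dashv N_v$ (which exists) has weak equivalences and fibrations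 created by $N_v$. Topology $\tau$: a functor $F$ is simplicially surjective if $(NF)_k$ is surjective for all $k\ge0$, where $N$ is the nerve. The singletons $\{F\}$ with $F$ simplicially surjective form a basis for a Grothendieck topology $\tau$ on $\mathbf{Cat}$. For a Grothendieck topology $\mathcal{T}$ on $\mathbf{Cat}$: a functor $p:\mathbf{E}\to\mathbf{B}$ is $\mathcal{T}$-epi if its image under the Yoneda embedding followed by sheafification is an epimorphism of sheaves; equivalently, for every functor $g:\mathbf{X}\to\mathbf{B}$ there are a covering family $\{f_i:\mathbf{U}_i\to\mathbf{X}\}_i$ (from a basis for $\mathcal T$) and functors $u_i:\mathbf{U}_i\to\mathbf{E}$ with $pu_i=gf_i$ for all $i$. Let $\mathsf{iso}(\mathbb{B})_1\subseteq\mathbb{B}_1$ be the subcategory of invertible horizontal morphisms and horizontally invertible squares. For a double functor $F:\mathbb{A}\to\mathbb{B}$ let $(\mathbb{P}_F)_0=\mathbb{A}_0\times_{\mathbb{B}_0}\mathsf{iso}(\mathbb{B})_1$ be the pullback of $F_0$ and $t:\mathsf{iso}(\mathbb{B})_1\to\mathbb{B}_0$, with projection $\overline F_0:(\mathbb{P}_F)_0\to\mathsf{iso}(\mathbb{B})_1$. $F$ is a $\mathcal{T}$-equivalence if $s\circ\overline F_0:(\mathbb{P}_F)_0\to\mathbb{B}_0$ is $\mathcal{T}$-epi and $F$ is fully faithful, i.e. the square formed by $F_1$, $F_0\times F_0$ and the two functors $(s,t)$ is a pullback in $\mathbf{Cat}$. $F$ is a $\mathcal{T}$-fibration if the induced functor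 $(r_F)_0:\mathsf{iso}(\mathbb{A})_1\to(\mathbb{P}_F)_0$ (with components $t$ and $\mathsf{iso}(F)_1$) is $\mathcal{T}$-epi. $\mathcal{T}$-cofibrations are the double functors with the left lifting property against all double functors that are both $\mathcal{T}$-fibrations and $\mathcal{T}$-equivalences. *)

(* Defs.v *)
From mathcomp Require Import all_boot.
From Stdlib Require Import ProofIrrelevance FunctionalExtensionality.

Set Implicit Arguments.
Unset Strict Implicit.
Unset Printing Implicit Defensive.

(* Categories are presented by a type of objects and a single type of arrows,
   with composition defined on the composable pairs.  Equality of objects,
   arrows and functors is then plain equality, so that strict pullbacks in Cat
   and internal categories in Cat involve no transport.  All composition (of
   arrows, functors, horizontal morphisms and squares) is written in
   diagrammatic order. *)

Record pbk (X Y Z : Type) (f : X -> Z) (g : Y -> Z) : Type :=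
  Pbk { p1 : X; p2 : Y; pbkP : f p1 = g p2 }.

Lemma pbk_ext X Y Z (f : X -> Z) (g : Y -> Z) (a b : pbk f g) :
  p1 a = p1 b -> p2 a = p2 b -> a = b.
Proof.
case: a b => [a1 a2 aP] [b1 b2 bP] /= E1 E2.
by subst; rewrite (proof_irrelevance _ aP bP).
Qed.

Record cat_laws (O M : Type) (d c : M -> O) (i : O -> M) (m : pbk c d -> M)
    : Prop := CatLaws {
  law_dom_id : forall x, d (i x) = x;
  law_cod_id : forall x, c (i x) = x;
  law_dom_comp : forall p, d (m p) = d (p1 p);
  law_cod_comp : forall p, c (m p) = c (p2 p);
  law_idl : forall f (H : c (i (d f)) = d f), m (Pbk H) = f;
  law_idr : forall f (H : c f = d (i (c f))), m (Pbk H) = f;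
  law_assoc : forall f g h (Hfg : c f = d g) (Hgh : c g = d h)
      (H1 : c (m (Pbk Hfg)) = d h) (H2 : c f = d (m (Pbk Hgh))),
      m (Pbk H1) = m (Pbk H2)
}.

Record Cat : Type := MkCat {
  Ob : Type;
  Mor : Type;
  dom : Mor -> Ob;
  cod : Mor -> Ob;
  idm : Ob -> Mor;
  cmp : pbk cod dom -> Mor;
  catP : cat_laws idm cmp
}.

Definition is_iso (C : Cat) (f : Mor C) : Prop :=
  exists (g : Mor C) (Hfg : cod f = dom g) (Hgf : cod g = dom f),
    cmp (Pbk Hfg) = idm (dom f) /\ cmp (Pbk Hgf) = idm (dom g).

Record functor_laws (C D : Cat) (fo : Ob C -> Ob D) (fm : Mor C -> Mor D)
    : Prop := FunctorLaws {
  law_dom : forall f, dom (fm f) = fo (dom f);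
  law_cod : forall f, cod (fm f) = fo (cod f);
  law_id : forall x, fm (idm x) = idm (fo x);
  law_comp : forall f g (H : cod f = dom g) (H' : cod (fm f) = dom (fm g)),
      fm (cmp (Pbk H)) = cmp (Pbk H')
}.

Record Functor (C D : Cat) : Type := MkFunctor {
  fob : Ob C -> Ob D;
  fmor : Mor C -> Mor D;
  functorP : functor_laws fob fmor
}.

Lemma functor_ext (C D : Cat) (F G : Functor C D) :
  (forall x, fob F x = fob G x) -> (forall f, fmor F f = fmor G f) -> F = G.
Proof.
case: F G => [Fo Fm FP] [Go Gm GP] /= Eo Em.
have E1 : Fo = Go by apply: functional_extensionality.
have E2 : Fm = Gm by apply: functional_extensionality.
by subst; rewrite (proof_irrelevance _ FP GP).
Qed.

Lemma functor_laws_id (C : Cat) : functor_laws (C := C) (D := C) id id.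
Proof.
by split=> // f g H H'; congr cmp; apply: pbk_ext.
Qed.

Definition fid (C : Cat) : Functor C C := MkFunctor (functor_laws_id C).

Lemma functor_laws_comp (C D E : Cat) (fo : Ob C -> Ob D) (fm : Mor C -> Mor D)
    (go : Ob D -> Ob E) (gm : Mor D -> Mor E) :
  functor_laws fo fm -> functor_laws go gm ->
  functor_laws (fun x => go (fo x)) (fun f => gm (fm f)).
Proof.
move=> FP GP; split.
- by move=> f; rewrite (law_dom GP) (law_dom FP).
- by move=> f; rewrite (law_cod GP) (law_cod FP).
- by move=> x; rewrite (law_id FP) (law_id GP).
- move=> f g H H'.
  have H'' : cod (fm f) = dom (fm g) by rewrite (law_cod FP) (law_dom FP) H.
  by rewrite (law_comp FP H H'') (law_comp GP H'' H').
Qed.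

Definition fcomp (C D E : Cat) (F : Functor C D) (G : Functor D E)
  : Functor C E :=
  MkFunctor (functor_laws_comp (functorP F) (functorP G)).

Lemma functor_iso (C D : Cat) (F : Functor C D) (f : Mor C) :
  is_iso f -> is_iso (fmor F f).
Proof.
case: F => fo fm FP [g [Hfg [Hgf [E1 E2]]]] /=.
have Hfg' : cod (fm f) = dom (fm g) by rewrite (law_cod FP) (law_dom FP) Hfg.
have Hgf' : cod (fm g) = dom (fm f) by rewrite (law_cod FP) (law_dom FP) Hgf.
exists (fm g), Hfg', Hgf'.
by rewrite -(law_comp FP Hfg) -(law_comp FP Hgf) E1 E2 !(law_id FP)
   !(law_dom FP).
Qed.

Definition nat_iso (C D : Cat) (F G : Functor C D) : Prop :=
  exists eta : Ob C -> Mor D,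
    [/\ forall x, dom (eta x) = fob F x,
        forall x, cod (eta x) = fob G x,
        forall x, is_iso (eta x)
      & forall f (H : cod (fmor F f) = dom (eta (cod f)))
               (H' : cod (eta (dom f)) = dom (fmor G f)),
          cmp (Pbk H) = cmp (Pbk H')].

Definition is_equivalence (C D : Cat) (F : Functor C D) : Prop :=
  exists G : Functor D C,
    nat_iso (fcomp F G) (fid C) /\ nat_iso (fcomp G F) (fid D).

Definition is_isofibration (A B : Cat) (F : Functor A B) : Prop :=
  forall (a : Ob A) (h : Mor B), is_iso h -> cod h = fob F a ->
    exists k : Mor A, [/\ is_iso k, cod k = a & fmor F k = h].

Definition is_iso_functor (C D : Cat) (F : Functor C D) : Prop :=
  exists G : Functor D C, fcomp F G = fid C /\ fcomp G F = fid D.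

Section Pullback.
Variables (X Y Z : Cat) (F : Functor X Z) (G : Functor Y Z).

Let FP := functorP F.
Let GP := functorP G.

Definition pb_ob : Type := pbk (fob F) (fob G).
Definition pb_mor : Type := pbk (fmor F) (fmor G).

Lemma pb_dom_subproof (f : pb_mor) :
  fob F (dom (p1 f)) = fob G (dom (p2 f)).
Proof. by rewrite -(law_dom FP) -(law_dom GP) (pbkP f). Qed.

Lemma pb_cod_subproof (f : pb_mor) :
  fob F (cod (p1 f)) = fob G (cod (p2 f)).
Proof. by rewrite -(law_cod FP) -(law_cod GP) (pbkP f). Qed.

Lemma pb_id_subproof (x : pb_ob) :
  fmor F (idm (p1 x)) = fmor G (idm (p2 x)).
Proof. by rewrite (law_id FP) (law_id GP) (pbkP x). Qed.

Definition pb_dom (f : pb_mor) : pb_ob := Pbk (pb_dom_subproof f).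
Definition pb_cod (f : pb_mor) : pb_ob := Pbk (pb_cod_subproof f).
Definition pb_id (x : pb_ob) : pb_mor := Pbk (pb_id_subproof x).

Definition pb_pair1 (p : pbk pb_cod pb_dom) : pbk (@cod X) (@dom X) :=
  @Pbk _ _ _ (@cod X) (@dom X) (p1 (p1 p)) (p1 (p2 p))
       (f_equal (fun x : pb_ob => p1 x) (pbkP p)).
Definition pb_pair2 (p : pbk pb_cod pb_dom) : pbk (@cod Y) (@dom Y) :=
  @Pbk _ _ _ (@cod Y) (@dom Y) (p2 (p1 p)) (p2 (p2 p))
       (f_equal (fun x : pb_ob => p2 x) (pbkP p)).

Lemma pb_cmp_subproof (p : pbk pb_cod pb_dom) :
  fmor F (cmp (pb_pair1 p)) = fmor G (cmp (pb_pair2 p)).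
Proof.
case: p => f g H; rewrite /pb_pair1 /pb_pair2 /=.
set H1 := f_equal _ H; set H2 := f_equal _ H.
have K1 : cod (fmor F (p1 f)) = dom (fmor F (p1 g)).
  by rewrite (law_cod FP) (law_dom FP); congr (fob F); exact: H1.
have K2 : cod (fmor G (p2 f)) = dom (fmor G (p2 g)).
  by rewrite (law_cod GP) (law_dom GP); congr (fob G); exact: H2.
rewrite (law_comp FP H1 K1) (law_comp GP H2 K2).
by congr cmp; apply: pbk_ext => /=; apply: pbkP.
Qed.

Definition pb_cmp (p : pbk pb_cod pb_dom) : pb_mor := Pbk (pb_cmp_subproof p).

Lemma pb_cat_laws : cat_laws pb_id pb_cmp.
Proof.
have [XP YP] := (catP X, catP Y); split.
- by move=> x; apply: pbk_ext => /=; [apply: law_dom_id XP _|apply: law_dom_id YP _].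
- by move=> x; apply: pbk_ext => /=; [apply: law_cod_id XP _|apply: law_cod_id YP _].
- by move=> p; apply: pbk_ext => /=;
    [rewrite (law_dom_comp XP)|rewrite (law_dom_comp YP)].
- by move=> p; apply: pbk_ext => /=;
    [rewrite (law_cod_comp XP)|rewrite (law_cod_comp YP)].
- by move=> f H; apply: pbk_ext => /=; [apply: law_idl XP _ _|apply: law_idl YP _ _].
- by move=> f H; apply: pbk_ext => /=; [apply: law_idr XP _ _|apply: law_idr YP _ _].
- by move=> f g h Hfg Hgh H1 H2; apply: pbk_ext => /=;
    [apply: (law_assoc XP)|apply: (law_assoc YP)].
Qed.

Definition pullback : Cat := MkCat pb_cat_laws.

Lemma pb_fst_laws : functor_laws (C := pullback) (D := X)
  (fun x : pb_ob => p1 x) (fun f : pb_mor => p1 f).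
Proof. by split=> // f g H H'; congr cmp; apply: pbk_ext. Qed.

Lemma pb_snd_laws : functor_laws (C := pullback) (D := Y)
  (fun x : pb_ob => p2 x) (fun f : pb_mor => p2 f).
Proof. by split=> // f g H H'; congr cmp; apply: pbk_ext. Qed.

Definition pb_fst : Functor pullback X := MkFunctor pb_fst_laws.
Definition pb_snd : Functor pullback Y := MkFunctor pb_snd_laws.

Section Lift.
Variables (W : Cat) (a : Functor W X) (b : Functor W Y).
Hypothesis ab : fcomp a F = fcomp b G.

Lemma pb_lift_ob_subproof (x : Ob W) : fob F (fob a x) = fob G (fob b x).
Proof. exact: (f_equal (fun K => fob K x) ab). Qed.

Lemma pb_lift_mor_subproof (f : Mor W) : fmor F (fmor a f) = fmor G (fmor b f).
Proof. exact: (f_equal (fun K => fmor K f) ab). Qed.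

Lemma pb_lift_laws : functor_laws (C := W) (D := pullback)
  (fun x => Pbk (pb_lift_ob_subproof x) : pb_ob)
  (fun f => Pbk (pb_lift_mor_subproof f) : pb_mor).
Proof.
have [aP bP] := (functorP a, functorP b); split.
- by move=> f; apply: pbk_ext => /=; [apply: law_dom aP _|apply: law_dom bP _].
- by move=> f; apply: pbk_ext => /=; [apply: law_cod aP _|apply: law_cod bP _].
- by move=> x; apply: pbk_ext => /=; [apply: law_id aP _|apply: law_id bP _].
- by move=> f g H H'; apply: pbk_ext => /=; [apply: (law_comp aP)|apply: (law_comp bP)].
Qed.

Definition pb_lift : Functor W pullback := MkFunctor pb_lift_laws.
End Lift.
End Pullback.

Section Product.
Variables X Y : Cat.

Definition prod_pair1
    (p : pbk (fun f : Mor X * Mor Y => (cod f.1, cod f.2))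
             (fun f => (dom f.1, dom f.2))) : pbk (@cod X) (@dom X) :=
  @Pbk _ _ _ (@cod X) (@dom X) (p1 p).1 (p2 p).1 (f_equal fst (pbkP p)).
Definition prod_pair2
    (p : pbk (fun f : Mor X * Mor Y => (cod f.1, cod f.2))
             (fun f => (dom f.1, dom f.2))) : pbk (@cod Y) (@dom Y) :=
  @Pbk _ _ _ (@cod Y) (@dom Y) (p1 p).2 (p2 p).2 (f_equal snd (pbkP p)).

Lemma prod_cat_laws : cat_laws
  (fun x : Ob X * Ob Y => (idm x.1, idm x.2))
  (fun p => (cmp (prod_pair1 p), cmp (prod_pair2 p))).
Proof.
have [XP YP] := (catP X, catP Y); split.
- by case=> x y /=; rewrite (law_dom_id XP) (law_dom_id YP).
- by case=> x y /=; rewrite (law_cod_id XP) (law_cod_id YP).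
- by move=> p /=; rewrite (law_dom_comp XP) (law_dom_comp YP).
- by move=> p /=; rewrite (law_cod_comp XP) (law_cod_comp YP).
- by case=> f g H; congr pair; [apply: law_idl XP _ _|apply: law_idl YP _ _].
- by case=> f g H; congr pair; [apply: law_idr XP _ _|apply: law_idr YP _ _].
- by move=> f g h Hfg Hgh H1 H2; congr pair;
    [apply: (law_assoc XP)|apply: (law_assoc YP)].
Qed.

Definition prodC : Cat := MkCat prod_cat_laws.
End Product.

Lemma pair_functor_laws (W X Y : Cat) (F : Functor W X) (G : Functor W Y) :
  functor_laws (C := W) (D := prodC X Y)
    (fun x => (fob F x, fob G x)) (fun f => (fmor F f, fmor G f)).
Proof.
have [FP GP] := (functorP F, functorP G); split=> /=.
- by move=> f; rewrite (law_dom FP) (law_dom GP).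
- by move=> f; rewrite (law_cod FP) (law_cod GP).
- by move=> x; rewrite (law_id FP) (law_id GP).
- by move=> f g H H'; congr pair; [apply: (law_comp FP)|apply: (law_comp GP)].
Qed.

Definition pair_functor (W X Y : Cat) (F : Functor W X) (G : Functor W Y)
  : Functor W (prodC X Y) := MkFunctor (pair_functor_laws F G).

Lemma prod_map_laws (X Y X' Y' : Cat) (F : Functor X X') (G : Functor Y Y') :
  functor_laws (C := prodC X Y) (D := prodC X' Y')
    (fun x => (fob F x.1, fob G x.2)) (fun f => (fmor F f.1, fmor G f.2)).
Proof.
have [FP GP] := (functorP F, functorP G); split=> /=.
- by move=> f; rewrite (law_dom FP) (law_dom GP).
- by move=> f; rewrite (law_cod FP) (law_cod GP).
- by move=> x; rewrite (law_id FP) (law_id GP).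
- by move=> f g H H'; congr pair; [apply: (law_comp FP)|apply: (law_comp GP)].
Qed.

Definition prod_map (X Y X' Y' : Cat) (F : Functor X X') (G : Functor Y Y')
  : Functor (prodC X Y) (prodC X' Y') := MkFunctor (prod_map_laws F G).

Definition is_pullback (P X Y Z : Cat) (p : Functor P X) (q : Functor P Y)
    (f : Functor X Z) (g : Functor Y Z) : Prop :=
  fcomp p f = fcomp q g /\
  forall (W : Cat) (a : Functor W X) (b : Functor W Y),
    fcomp a f = fcomp b g ->
    exists! h : Functor W P, fcomp h p = a /\ fcomp h q = b.

(* string C k is (N C)_k, the composable strings x_0 -> x_1 -> ... -> x_k of k
   arrows; the vertices are recorded so that string C 0 is Ob C. *)

Record string (C : Cat) (k : nat) : Type := Str {
  sob : 'I_k.+1 -> Ob C;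
  sar : 'I_k -> Mor C;
  sdom : forall i : 'I_k, dom (sar i) = sob (widen_ord (leqnSn k) i);
  scod : forall i : 'I_k, cod (sar i) = sob (lift ord0 i)
}.

Lemma string_ext (C : Cat) k (x y : string C k) :
  (forall i, sob x i = sob y i) -> (forall i, sar x i = sar y i) -> x = y.
Proof.
case: x y => [xo xa xd xc] [yo ya yd yc] /= Eo Ea.
have E1 : xo = yo by apply: functional_extensionality.
have E2 : xa = ya by apply: functional_extensionality.
by subst; rewrite (proof_irrelevance _ xd yd) (proof_irrelevance _ xc yc).
Qed.

Section StringMap.
Variables (C D : Cat) (F : Functor C D) (k : nat) (x : string C k).

Lemma string_map_dom (i : 'I_k) :
  dom (fmor F (sar x i)) = fob F (sob x (widen_ord (leqnSn k) i)).
Proof. by rewrite (law_dom (functorP F)) sdom. Qed.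

Lemma string_map_cod (i : 'I_k) :
  cod (fmor F (sar x i)) = fob F (sob x (lift ord0 i)).
Proof. by rewrite (law_cod (functorP F)) scod. Qed.

Definition string_map : string D k :=
  @Str D k (fun i => fob F (sob x i)) (fun i => fmor F (sar x i))
       string_map_dom string_map_cod.
End StringMap.

Definition simplicially_surjective (C D : Cat) (F : Functor C D) : Prop :=
  forall (k : nat) (y : string D k), exists x : string C k, string_map F x = y.

(* A string of pairs is a pair of strings: (N (X x_Z Y))_k is the pullback of
   (N X)_k and (N Y)_k over (N Z)_k. *)
Section StringPair.
Variables (X Y Z : Cat) (F : Functor X Z) (G : Functor Y Z) (k : nat).
Variable p : pbk (@string_map _ _ F k) (@string_map _ _ G k).

Lemma string_pair_ob i : fob F (sob (p1 p) i) = fob G (sob (p2 p) i).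
Proof. exact: (f_equal (fun s => sob s i) (pbkP p)). Qed.

Lemma string_pair_ar i : fmor F (sar (p1 p) i) = fmor G (sar (p2 p) i).
Proof. exact: (f_equal (fun s => sar s i) (pbkP p)). Qed.

Lemma string_pair_dom (i : 'I_k) :
  @dom (pullback F G) (Pbk (string_pair_ar i)) =
  Pbk (string_pair_ob (widen_ord (leqnSn k) i)).
Proof. by apply: pbk_ext => /=; apply: sdom. Qed.

Lemma string_pair_cod (i : 'I_k) :
  @cod (pullback F G) (Pbk (string_pair_ar i)) =
  Pbk (string_pair_ob (lift ord0 i)).
Proof. by apply: pbk_ext => /=; apply: scod. Qed.

Definition string_pair : string (pullback F G) k :=
  @Str (pullback F G) k (fun i => Pbk (string_pair_ob i))
       (fun i => Pbk (string_pair_ar i)) string_pair_dom string_pair_cod.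
End StringPair.

Record cover_family (X : Cat) : Type := CoverFamily {
  cidx : Type;
  cdom : cidx -> Cat;
  cmap : forall i, Functor (cdom i) X
}.
Arguments cdom {X} c i.
Arguments cmap {X} c i.

Record basis : Type := Basis {
  covers : forall X : Cat, cover_family X -> Prop;
  covers_iso : forall (U X : Cat) (F : Functor U X), is_iso_functor F ->
    covers (CoverFamily (fun _ : unit => F));
  covers_pullback : forall (X Y : Cat) (c : cover_family X) (G : Functor Y X),
    covers c -> covers (CoverFamily (fun i => pb_snd (cmap c i) G));
  covers_trans : forall (X : Cat) (c : cover_family X)
      (e : forall i, cover_family (cdom c i)),
    covers c -> (forall i, covers (e i)) ->
    covers (CoverFamily (fun ij : {i : cidx c & cidx (e i)} =>
      fcomp (cmap (e (projT1 ij)) (projT2 ij)) (cmap c (projT1 ij))))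
}.

(* The singleton families consisting of a simplicially surjective functor. *)
Definition tau_covers (X : Cat) (c : cover_family X) : Prop :=
  exists i : cidx c, (forall j, j = i) /\ simplicially_surjective (cmap c i).

Lemma tau_covers_iso (U X : Cat) (F : Functor U X) :
  is_iso_functor F -> tau_covers (CoverFamily (fun _ : unit => F)).
Proof.
case=> G [_ GF]; exists tt; split; first by case.
move=> k y; exists (string_map G y); apply: string_ext => i /=.
- exact: (f_equal (fun K => fob K (sob y i)) GF).
- exact: (f_equal (fun K => fmor K (sar y i)) GF).
Qed.

Lemma tau_covers_pullback (X Y : Cat) (c : cover_family X) (G : Functor Y X) :
  tau_covers c -> tau_covers (CoverFamily (fun i => pb_snd (cmap c i) G)).
Proof.
case=> i [ci cs]; exists i; split=> //= k y.
have [x xy] := cs k (string_map G y).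
by exists (string_pair (Pbk xy)); apply: string_ext.
Qed.

Lemma tau_covers_trans (X : Cat) (c : cover_family X)
    (e : forall i, cover_family (cdom c i)) :
  tau_covers c -> (forall i, tau_covers (e i)) ->
  tau_covers (CoverFamily (fun ij : {i : cidx c & cidx (e i)} =>
    fcomp (cmap (e (projT1 ij)) (projT2 ij)) (cmap c (projT1 ij)))).
Proof.
case=> i [ci cs] /(_ i) [j [ej es]]; exists (existT _ i j); split=> [[i' j']|] /=.
  by have Ei := ci i'; subst i'; rewrite (ej j').
move=> k y; have [x <-] := cs k y; have [z <-] := es k x.
by exists z; apply: string_ext.
Qed.

Definition tau : basis :=
  Basis tau_covers_iso tau_covers_pullback tau_covers_trans.

(* The local-lifting form of: the Yoneda image of p is an epimorphism after
   sheafification for the topology with basis T. *)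
Definition T_epi (T : basis) (E B : Cat) (p : Functor E B) : Prop :=
  forall (X : Cat) (g : Functor X B),
    exists c : cover_family X, covers T c /\
      forall i : cidx c, exists u : Functor (cdom c i) E,
        fcomp u p = fcomp (cmap c i) g.

(* Double categories: internal categories in Cat.  An equation between functors
   is an equation on objects and one on arrows, so the axioms of an internal
   category say that (B0, B1, hsrc, htgt, hid, hcmp) satisfies the axioms of a
   category at the level of objects (objects and horizontal morphisms) and at
   the level of arrows (vertical morphisms and squares). *)

Record DblCat : Type := MkDblCat {
  D0 : Cat;
  D1 : Cat;
  hsrc : Functor D1 D0;
  htgt : Functor D1 D0;
  hid : Functor D0 D1;
  hcmp : Functor (pullback htgt hsrc) D1;
  dbl_obP : cat_laws (d := fob hsrc) (c := fob htgt) (fob hid) (fob hcmp);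
  dbl_morP : cat_laws (d := fmor hsrc) (c := fmor htgt) (fmor hid) (fmor hcmp)
}.

(* Objects and horizontal morphisms. *)
Definition hcat (B : DblCat) : Cat := MkCat (dbl_obP B).
(* Vertical morphisms and squares, composed horizontally. *)
Definition sqcat (B : DblCat) : Cat := MkCat (dbl_morP B).

Record DblFunctor (A B : DblCat) : Type := MkDblFunctor {
  F0 : Functor (D0 A) (D0 B);
  F1 : Functor (D1 A) (D1 B);
  dblfun_obP : functor_laws (C := hcat A) (D := hcat B) (fob F0) (fob F1);
  dblfun_morP : functor_laws (C := sqcat A) (D := sqcat B) (fmor F0) (fmor F1)
}.

Definition dfcomp (A B C : DblCat) (F : DblFunctor A B) (G : DblFunctor B C)
  : DblFunctor A C :=
  @MkDblFunctor A C (fcomp (F0 F) (F0 G)) (fcomp (F1 F) (F1 G))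
    (functor_laws_comp (dblfun_obP F) (dblfun_obP G))
    (functor_laws_comp (dblfun_morP F) (dblfun_morP G)).

Definition hcat_map (A B : DblCat) (F : DblFunctor A B)
  : Functor (hcat A) (hcat B) := MkFunctor (dblfun_obP F).
Definition sqcat_map (A B : DblCat) (F : DblFunctor A B)
  : Functor (sqcat A) (sqcat B) := MkFunctor (dblfun_morP F).

Definition has_llp (A B C D : DblCat) (i : DblFunctor A B) (p : DblFunctor C D)
  : Prop :=
  forall (u : DblFunctor A C) (v : DblFunctor B D),
    dfcomp u p = dfcomp i v ->
    exists h : DblFunctor B C, dfcomp i h = u /\ dfcomp h p = v.

(* Objects are the k-strings of vertical morphisms, arrows the k-strings of
   squares (arrows of D1), composed horizontally. *)
Section VerticalNerve.
Variables (B : DblCat) (k : nat).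

Lemma Nv_laws : cat_laws
  (d := @string_map _ _ (hsrc B) k) (c := @string_map _ _ (htgt B) k)
  (@string_map _ _ (hid B) k)
  (fun p => string_map (hcmp B) (string_pair p)).
Proof.
have [oP mP] := (dbl_obP B, dbl_morP B); split.
- by move=> x; apply: string_ext => i /=; [apply: law_dom_id oP _|apply: law_dom_id mP _].
- by move=> x; apply: string_ext => i /=; [apply: law_cod_id oP _|apply: law_cod_id mP _].
- by move=> p; apply: string_ext => i /=;
    [rewrite (law_dom_comp oP)|rewrite (law_dom_comp mP)].
- by move=> p; apply: string_ext => i /=;
    [rewrite (law_cod_comp oP)|rewrite (law_cod_comp mP)].
- by move=> f H; apply: string_ext => i /=; [apply: law_idl oP _ _|apply: law_idl mP _ _].
- by move=> f H; apply: string_ext => i /=; [apply: law_idr oP _ _|apply: law_idr mP _ _].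
- by move=> f g h Hfg Hgh H1 H2; apply: string_ext => i /=;
    [apply: (law_assoc oP)|apply: (law_assoc mP)].
Qed.

Definition Nv : Cat := MkCat Nv_laws.
End VerticalNerve.

Section VerticalNerveMap.
Variables (A B : DblCat) (K : DblFunctor A B) (k : nat).

Lemma Nv_map_laws : functor_laws (C := Nv A k) (D := Nv B k)
  (@string_map _ _ (F0 K) k) (@string_map _ _ (F1 K) k).
Proof.
have [oP mP] := (dblfun_obP K, dblfun_morP K); split.
- by move=> x; apply: string_ext => i /=; [apply: law_dom oP _|apply: law_dom mP _].
- by move=> x; apply: string_ext => i /=; [apply: law_cod oP _|apply: law_cod mP _].
- by move=> x; apply: string_ext => i /=; [apply: law_id oP _|apply: law_id mP _].
- by move=> f g H H'; apply: string_ext => i /=;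
    [apply: (law_comp oP)|apply: (law_comp mP)].
Qed.

Definition Nv_map : Functor (Nv A k) (Nv B k) := MkFunctor Nv_map_laws.
End VerticalNerveMap.

(* The category of invertible horizontal morphisms and horizontally invertible
   squares, a subcategory of D1. *)

Section Iso1.
Variable B : DblCat.

Definition iso_ob : Type := {f : Mor (hcat B) | is_iso f}.
Definition iso_mor : Type := {a : Mor (sqcat B) | is_iso a}.

(* The vertical source, target and identity are functors between the horizontal
   categories. *)
Lemma vdom_laws : functor_laws (C := sqcat B) (D := hcat B)
  (@dom (D0 B)) (@dom (D1 B)).
Proof.
split.
- by move=> f; rewrite /= (law_dom (functorP (hsrc B))).
- by move=> f; rewrite /= (law_dom (functorP (htgt B))).
- by move=> f; rewrite /= (law_dom (functorP (hid B))).
- move=> f g H H'; rewrite /= (law_dom (functorP (hcmp B))).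
  by congr (fob (hcmp B)); apply: pbk_ext.
Qed.

Lemma vcod_laws : functor_laws (C := sqcat B) (D := hcat B)
  (@cod (D0 B)) (@cod (D1 B)).
Proof.
split.
- by move=> f; rewrite /= (law_cod (functorP (hsrc B))).
- by move=> f; rewrite /= (law_cod (functorP (htgt B))).
- by move=> f; rewrite /= (law_cod (functorP (hid B))).
- move=> f g H H'; rewrite /= (law_cod (functorP (hcmp B))).
  by congr (fob (hcmp B)); apply: pbk_ext.
Qed.

Lemma vid_laws : functor_laws (C := hcat B) (D := sqcat B)
  (@idm (D0 B)) (@idm (D1 B)).
Proof.
split.
- by move=> f; rewrite /= (law_id (functorP (hsrc B))).
- by move=> f; rewrite /= (law_id (functorP (htgt B))).
- by move=> f; rewrite /= (law_id (functorP (hid B))).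
- move=> f g H H'; rewrite /= -(law_id (functorP (hcmp B))).
  by congr (fmor (hcmp B)); apply: pbk_ext.
Qed.

Definition iso_dom (a : iso_mor) : iso_ob :=
  exist _ _ (functor_iso (MkFunctor vdom_laws) (proj2_sig a)).
Definition iso_cod (a : iso_mor) : iso_ob :=
  exist _ _ (functor_iso (MkFunctor vcod_laws) (proj2_sig a)).
Definition iso_id (f : iso_ob) : iso_mor :=
  exist _ _ (functor_iso (MkFunctor vid_laws) (proj2_sig f)).

Definition iso_pair (p : pbk iso_cod iso_dom) : pbk (@cod (D1 B)) (@dom (D1 B)) :=
  @Pbk _ _ _ (@cod (D1 B)) (@dom (D1 B)) (proj1_sig (p1 p)) (proj1_sig (p2 p))
       (f_equal (@proj1_sig _ _) (pbkP p)).

Lemma inverse_unique (C : Cat) (f g g' : Mor C)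
    (Hfg : cod f = dom g) (Hgf : cod g = dom f)
    (Hfg' : cod f = dom g') (Hgf' : cod g' = dom f) :
  cmp (Pbk Hgf) = idm (dom g) -> cmp (Pbk Hfg') = idm (dom f) -> g = g'.
Proof.
move=> E1 E2; have CP := catP C.
have K1 : cod g = dom (cmp (Pbk Hfg')) by rewrite (law_dom_comp CP).
have K2 : cod (cmp (Pbk Hgf)) = dom g' by rewrite (law_cod_comp CP).
have E := law_assoc CP K2 K1.
move: K1 K2 E; rewrite E1 E2 -Hgf => K1 K2.
rewrite (law_idr CP).
move: K2; rewrite -Hfg Hfg' => K2.
by rewrite (law_idl CP).
Qed.

(* Vertical composites of horizontally invertible squares are horizontally
   invertible, by interchange. *)
Lemma iso_cmp_subproof (p : pbk iso_cod iso_dom) :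
  is_iso (C := sqcat B) (cmp (iso_pair p)).
Proof.
case: p => [[a [a' [Ha [Ha' [Ea Ea']]]]] [b [b' [Hb [Hb' [Eb Eb']]]]] H].
rewrite /iso_pair /=; set H1 := f_equal _ H; move: H1 => /= H1 {H}.
pose V := MkFunctor vcod_laws; pose W := MkFunctor vdom_laws.
have [Vl Wl] := (functorP V, functorP W).
have invV : cod (a' : Mor (D1 B)) = dom (b' : Mor (D1 B)).
  have K1 : @cod (hcat B) (fmor V a) = dom (fmor V a').
    by rewrite (law_cod Vl) (law_dom Vl) Ha.
  have K2 : @cod (hcat B) (fmor V a') = dom (fmor V a).
    by rewrite (law_cod Vl) (law_dom Vl) Ha'.
  have K3 : @cod (hcat B) (fmor W b) = dom (fmor W b').
    by rewrite (law_cod Wl) (law_dom Wl) Hb.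
  have K4 : @cod (hcat B) (fmor W b') = dom (fmor W b).
    by rewrite (law_cod Wl) (law_dom Wl) Hb'.
  have H1' : fmor V a = fmor W b by exact: H1.
  have E2 : cmp (Pbk K2) = idm (dom (fmor V a')).
    by rewrite -(law_comp Vl Ha') Ea' (law_id Vl) (law_dom Vl).
  have E3 : cmp (Pbk K3) = idm (dom (fmor W b)).
    by rewrite -(law_comp Wl Hb) Eb (law_id Wl) (law_dom Wl).
  move: K1 K2 E2; rewrite H1' => K1 K2 E2.
  exact: (@inverse_unique _ _ _ _ K1 K2 K3 K4).
have mid (x y : Mor (sqcat B)) (xy : @cod (D1 B) x = @dom (D1 B) y)
    (x' y' : Mor (sqcat B)) (xy' : @cod (D1 B) x' = @dom (D1 B) y')
    (Hx : @cod (sqcat B) x = @dom (sqcat B) x')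
    (Hy : @cod (sqcat B) y = @dom (sqcat B) y')
    (Hc : @cod (sqcat B) (@cmp (D1 B) (Pbk xy)) =
          @dom (sqcat B) (@cmp (D1 B) (Pbk xy'))) :
    @cmp (sqcat B) (Pbk Hx) = idm (dom x) ->
    @cmp (sqcat B) (Pbk Hy) = idm (dom y) ->
    @cmp (sqcat B) (Pbk Hc) =
      @idm (sqcat B) (@dom (sqcat B) (@cmp (D1 B) (Pbk xy))).
  move=> Ex Ey.
  pose q : @pb_mor (D1 B) (D1 B) (D0 B) (htgt B) (hsrc B) := Pbk Hx.
  pose r : @pb_mor (D1 B) (D1 B) (D0 B) (htgt B) (hsrc B) := Pbk Hy.
  have Hqr : @cod (pullback (htgt B) (hsrc B)) q =
             @dom (pullback (htgt B) (hsrc B)) r by apply: pbk_ext.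
  have Hqr' : cod (fmor (hcmp B) q) = dom (fmor (hcmp B) r).
    by rewrite (law_cod (functorP (hcmp B))) (law_dom (functorP (hcmp B))) Hqr.
  have E := law_comp (functorP (hcmp B)) Hqr Hqr'.
  have Hs : cod (fmor (hsrc B) x) = dom (fmor (hsrc B) y).
    by rewrite (law_cod (functorP (hsrc B))) (law_dom (functorP (hsrc B))) xy.
  have Hu : cod (fmor (hid B) (fmor (hsrc B) x))
          = dom (fmor (hid B) (fmor (hsrc B) y)).
    by rewrite (law_cod (functorP (hid B))) (law_dom (functorP (hid B))) Hs.
  transitivity (fmor (hcmp B) (@cmp (pullback (htgt B) (hsrc B)) (Pbk Hqr))).
    rewrite /=; congr (fmor (hcmp B)); apply: pbk_ext => /=.
    - by congr cmp; apply: pbk_ext.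
    - by congr cmp; apply: pbk_ext.
  rewrite E /= (law_comp (functorP (hsrc B)) xy Hs) (law_comp (functorP (hid B)) Hs Hu).
  by congr cmp; apply: pbk_ext.
have dc (x y : Mor (D1 B)) (xy : cod x = dom y) (x' y' : Mor (D1 B))
    (xy' : cod x' = dom y') :
    fmor (htgt B) x = fmor (hsrc B) x' -> fmor (htgt B) y = fmor (hsrc B) y' ->
    fmor (htgt B) (cmp (Pbk xy)) = fmor (hsrc B) (cmp (Pbk xy')).
  move=> Ex Ey.
  have Kt : cod (fmor (htgt B) x) = dom (fmor (htgt B) y).
    by rewrite (law_cod (functorP (htgt B))) (law_dom (functorP (htgt B))) xy.
  have Ks : cod (fmor (hsrc B) x') = dom (fmor (hsrc B) y').
    by rewrite (law_cod (functorP (hsrc B))) (law_dom (functorP (hsrc B))) xy'.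
  rewrite (law_comp (functorP (htgt B)) xy Kt) (law_comp (functorP (hsrc B)) xy' Ks).
  by congr cmp; apply: pbk_ext.
exists (@cmp (D1 B) (Pbk invV)), (dc _ _ _ _ _ _ Ha Hb), (dc _ _ _ _ _ _ Ha' Hb').
by split; apply: mid.
Qed.

Definition iso_cmp (p : pbk iso_cod iso_dom) : iso_mor :=
  exist _ _ (iso_cmp_subproof p).

Lemma iso_ext (C : Cat) (x y : {f : Mor C | is_iso f}) :
  proj1_sig x = proj1_sig y -> x = y.
Proof.
case: x y => [x xP] [y yP] /= E; subst.
by rewrite (proof_irrelevance _ xP yP).
Qed.

Lemma iso_cat_laws : cat_laws iso_id iso_cmp.
Proof.
have CP := catP (D1 B); split.
- by move=> x; apply: iso_ext; apply: law_dom_id CP _.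
- by move=> x; apply: iso_ext; apply: law_cod_id CP _.
- by move=> p; apply: iso_ext; rewrite /= (law_dom_comp CP).
- by move=> p; apply: iso_ext; rewrite /= (law_cod_comp CP).
- by move=> f H; apply: iso_ext; apply: law_idl CP _ _.
- by move=> f H; apply: iso_ext; apply: law_idr CP _ _.
- by move=> f g h Hfg Hgh H1 H2; apply: iso_ext; apply: (law_assoc CP).
Qed.

Definition iso1 : Cat := MkCat iso_cat_laws.

Lemma iso1_incl_laws : functor_laws (C := iso1) (D := D1 B)
  (fun f : iso_ob => proj1_sig f) (fun a : iso_mor => proj1_sig a).
Proof. by split=> // f g H H'; congr cmp; apply: pbk_ext. Qed.

Definition iso1_incl : Functor iso1 (D1 B) := MkFunctor iso1_incl_laws.
Definition iso_src : Functor iso1 (D0 B) := fcomp iso1_incl (hsrc B).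
Definition iso_tgt : Functor iso1 (D0 B) := fcomp iso1_incl (htgt B).

End Iso1.

Section TNotions.
Variables (A B : DblCat) (F : DblFunctor A B).

Definition iso1_map_ob (f : iso_ob A) : iso_ob B :=
  exist _ _ (functor_iso (hcat_map F) (proj2_sig f)).
Definition iso1_map_mor (a : iso_mor A) : iso_mor B :=
  exist _ _ (functor_iso (sqcat_map F) (proj2_sig a)).

Lemma iso1_map_laws :
  functor_laws (C := iso1 A) (D := iso1 B) iso1_map_ob iso1_map_mor.
Proof.
have FP := functorP (F1 F); split.
- by move=> f; apply: iso_ext; apply: law_dom FP _.
- by move=> f; apply: iso_ext; apply: law_cod FP _.
- by move=> x; apply: iso_ext; apply: law_id FP _.
- by move=> f g H H'; apply: iso_ext; apply: (law_comp FP).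
Qed.

Definition iso1_map : Functor (iso1 A) (iso1 B) := MkFunctor iso1_map_laws.

Definition PF0 : Cat := pullback (F0 F) (iso_tgt B).
Definition Fbar0 : Functor PF0 (iso1 B) := pb_snd (F0 F) (iso_tgt B).

Lemma iso_tgt_map : fcomp (iso_tgt A) (F0 F) = fcomp iso1_map (iso_tgt B).
Proof.
apply: functor_ext => x /=.
- by rewrite -(law_cod (dblfun_obP F)).
- by rewrite -(law_cod (dblfun_morP F)).
Qed.

Definition rF0 : Functor (iso1 A) PF0 := pb_lift iso_tgt_map.

Definition fully_faithful : Prop :=
  is_pullback (F1 F) (pair_functor (hsrc A) (htgt A))
              (pair_functor (hsrc B) (htgt B)) (prod_map (F0 F) (F0 F)).

Definition T_equivalence (T : basis) : Prop :=
  T_epi T (fcomp Fbar0 (iso_src B)) /\ fully_faithful.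

Definition T_fibration (T : basis) : Prop := T_epi T rF0.

End TNotions.

Record model_classes : Type := ModelClasses {
  weq : forall A B : DblCat, DblFunctor A B -> Prop;
  fib : forall A B : DblCat, DblFunctor A B -> Prop;
  cof : forall A B : DblCat, DblFunctor A B -> Prop
}.

Definition T_cofibration (T : basis) (A B : DblCat) (i : DblFunctor A B)
  : Prop :=
  forall (C D : DblCat) (p : DblFunctor C D),
    T_fibration p T -> T_equivalence p T -> has_llp i p.

Definition topology_model (T : basis) : model_classes :=
  ModelClasses (fun A B F => T_equivalence F T) (fun A B F => T_fibration F T)
               (T_cofibration T).

(* The transferred structure: weak equivalences and fibrations are created by
   the vertical nerve from the levelwise ones; as in any model structure, the
   cofibrations are then the functors with the left lifting property against
   the trivial fibrations. *)
Definition transferred_weq (A B : DblCat) (K : DblFunctor A B) : Prop :=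
  forall k : nat, is_equivalence (Nv_map K k).

Definition transferred_fib (A B : DblCat) (K : DblFunctor A B) : Prop :=
  forall k : nat, is_isofibration (Nv_map K k).

Definition transferred_cof (A B : DblCat) (i : DblFunctor A B) : Prop :=
  forall (C D : DblCat) (p : DblFunctor C D),
    transferred_fib p -> transferred_weq p -> has_llp i p.

Definition transferred_model : model_classes :=
  ModelClasses transferred_weq transferred_fib transferred_cof.

(* Main.v *)
(* A functor is tau-epi iff it is simplicially surjective, because the pullback
   of a simplicially surjective functor along any g is a cover on which g
   lifts.  A k-string of iso(B)_1 is the same thing as an isomorphism
   of (N_v B)_k, so simplicial surjectivity of (r_K)_0 says that every (N_v K)_k
   is an isofibration, and that of s o Kbar_0 says that every (N_v K)_k is
   essentially surjective.  The pullback condition on K says that K is full and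
   faithful both on horizontal morphisms and on squares, which is full
   faithfulness of (N_v K)_k for k = 0 and 1, hence for all k. *)

Require Import Defs.
From mathcomp Require Import all_boot.
From Stdlib Require Import ProofIrrelevance IndefiniteDescription.

Set Implicit Arguments.
Unset Strict Implicit.
Unset Printing Implicit Defensive.

(** * Arrows with prescribed endpoints *)

(** In [Cat] all arrows share one type and [cmp] takes a proof of composability. Indexing arrows by
    their endpoints makes composition total, so that composites can be rewritten without carrying
    such proofs. *)
Record hom (C : Cat) (x y : Ob C) : Type := Hom {
  hmor :> Mor C;
  hdom : dom hmor = x;
  hcod : cod hmor = y
}.

Lemma hom_ext C (x y : Ob C) (f g : hom x y) :
  hmor f = hmor g -> f = g.
Proof.
case: f g => [f fd fc] [g gd gc] /= E; subst f.
by rewrite (proof_irrelevance _ fd gd) (proof_irrelevance _ fc gc).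
Qed.

Lemma cmp_eq (C : Cat) (f f' g g' : Mor C) (H : cod f = dom g)
    (H' : cod f' = dom g') :
  f = f' -> g = g' -> cmp (Pbk H) = cmp (Pbk H').
Proof. by move=> Ef Eg; congr cmp; apply: pbk_ext. Qed.

Section HomOps.
Variable C : Cat.
Let CP := catP C.

Definition mkhom (f : Mor C) : hom (dom f) (cod f) := Hom erefl erefl.

Definition hom_id (x : Ob C) : hom x x :=
  Hom (law_dom_id CP x) (law_cod_id CP x).

Definition hom_comp (x y z : Ob C) (f : hom x y) (g : hom y z) : hom x z :=
  let p := @Pbk _ _ _ (@cod C) (@dom C) f g (etrans (hcod f) (esym (hdom g))) in
  Hom (etrans (law_dom_comp CP p) (hdom f)) (etrans (law_cod_comp CP p) (hcod g)).

Local Notation "f ;; g" := (hom_comp f g) (at level 50, left associativity).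

Lemma hom_idl x y (f : hom x y) : hom_id x ;; f = f.
Proof.
apply: hom_ext => /=; case: f => f E1 E2 /=; subst.
exact: (law_idl CP).
Qed.

Lemma hom_idr x y (f : hom x y) : f ;; hom_id y = f.
Proof.
apply: hom_ext => /=; case: f => f E1 E2 /=; subst.
exact: (law_idr CP).
Qed.

Lemma hom_assoc x y z w (f : hom x y) (g : hom y z) (h : hom z w) :
  f ;; (g ;; h) = f ;; g ;; h.
Proof. by apply: hom_ext => /=; symmetry; apply: (law_assoc CP). Qed.

Definition hom_inverse x y (f : hom x y) (g : hom y x) : Prop :=
  f ;; g = hom_id x /\ g ;; f = hom_id y.

Lemma is_iso_hom x y (f : hom x y) :
  is_iso f <-> exists g, hom_inverse f g.
Proof.
split.
- case: f => f E1 E2 [g [Hfg [Hgf [E3 E4]]]] /=; subst.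
  exists (Hom (esym Hfg) Hgf); split; apply: hom_ext => /=.
    by rewrite -E3; apply: cmp_eq.
  by rewrite Hfg -E4; apply: cmp_eq.
- case=> g [E3 E4].
  exists g, (etrans (hcod f) (esym (hdom g))), (etrans (hcod g) (esym (hdom f))).
  split.
    by etransitivity; [apply: (f_equal (@hmor C x x) E3)|rewrite (hdom f)].
  by etransitivity; [apply: (f_equal (@hmor C y y) E4)|rewrite (hdom g)].
Qed.

Lemma is_iso_inverse x y (f : hom x y) (g : hom y x) :
  hom_inverse f g -> is_iso f.
Proof. by move=> fg; apply/is_iso_hom; exists g. Qed.

Lemma is_iso_inverse_sym x y (f : hom x y) (g : hom y x) :
  hom_inverse f g -> is_iso g.
Proof. by case=> fg gf; apply/is_iso_hom; exists f. Qed.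

Lemma iso_cancel_l x y z (f : hom x y) (g h : hom y z) :
  is_iso f -> f ;; g = f ;; h -> g = h.
Proof.
case/is_iso_hom=> k [_ kf] E.
by rewrite -(hom_idl g) -(hom_idl h) -kf -!hom_assoc E.
Qed.

Lemma iso_cancel_r x y z (f : hom y z) (g h : hom x y) :
  is_iso f -> g ;; f = h ;; f -> g = h.
Proof.
case/is_iso_hom=> k [fk _] E.
by rewrite -(hom_idr g) -(hom_idr h) -fk !hom_assoc E.
Qed.

End HomOps.

Notation "f ;; g" := (hom_comp f g) (at level 50, left associativity).

(** * Action of functors on hom-sets; full, faithful, essentially surjective functors *)

Section HomMap.
Variables (C D : Cat) (F : Functor C D).
Let FP := functorP F.

Definition hom_map x y (f : hom x y) : hom (fob F x) (fob F y) :=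
  Hom (etrans (law_dom FP f) (f_equal (fob F) (hdom f)))
      (etrans (law_cod FP f) (f_equal (fob F) (hcod f))).

Lemma hom_map_id x : hom_map (hom_id x) = hom_id (fob F x).
Proof. by apply: hom_ext; apply: law_id FP _. Qed.

Lemma hom_map_comp x y z (f : hom x y) (g : hom y z) :
  hom_map (f ;; g) = hom_map f ;; hom_map g.
Proof. by apply: hom_ext; apply: (law_comp FP). Qed.

Definition full : Prop :=
  forall x y (g : Mor D), dom g = fob F x -> cod g = fob F y ->
    exists f : Mor C, [/\ dom f = x, cod f = y & fmor F f = g].

Definition faithful : Prop :=
  forall f f' : Mor C, dom f = dom f' -> cod f = cod f' ->
    fmor F f = fmor F f' -> f = f'.

Definition ess_surj : Prop :=
  forall d : Ob D, exists c h, [/\ is_iso h, dom h = d & cod h = fob F c].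

Lemma full_hom : full -> forall x y (g : hom (fob F x) (fob F y)),
  exists f : hom x y, hom_map f = g.
Proof.
move=> fullF x y g; have [f [fd fc E]] := fullF x y g (hdom g) (hcod g).
by exists (Hom fd fc); apply: hom_ext.
Qed.

Lemma faithful_hom : faithful -> forall x y (f f' : hom x y),
  hom_map f = hom_map f' -> f = f'.
Proof.
move=> faithF x y f f' E; apply: hom_ext; apply: faithF.
- by rewrite !hdom.
- by rewrite !hcod.
- exact: (f_equal (@hmor _ _ _) E).
Qed.

End HomMap.

(** * Equivalences as the full, faithful and essentially surjective functors *)

Lemma nat_isoP (C D : Cat) (F G : Functor C D) :
  nat_iso F G <->
  exists eta : forall x, hom (fob F x) (fob G x),
    (forall x, is_iso (eta x)) /\
    forall x y (f : hom x y), hom_map F f ;; eta y = eta x ;; hom_map G f.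
Proof.
split.
- case=> eta [ed ec ei en].
  exists (fun x => Hom (ed x) (ec x)); split=> // x y [f fd fc]; subst.
  by apply: hom_ext; apply: en.
- case=> eta [ei en]; exists eta; split=> [x|x||f H H'] //.
  + exact: hdom.
  + exact: hcod.
  + have /(f_equal (@hmor _ _ _)) /= := en _ _ (mkhom f).
    by move=> E; etransitivity; [|etransitivity; [exact: E|]]; apply: cmp_eq.
Qed.

Lemma equivalence_ess_surj (C D : Cat) (F : Functor C D) :
  is_equivalence F -> ess_surj F.
Proof.
case=> G [_ /nat_isoP [eps [epsI _]]] d.
have [h hI] := proj1 (is_iso_hom _) (epsI d).
exists (fob G d), h; split; [exact: is_iso_inverse_sym hI|exact: hdom|exact: hcod].
Qed.

(** Naturality gives [G (F f) ;; eta y = eta x ;; f], and cancelling the isomorphism [eta x]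
    recovers [f] from [F f]. Since a single natural isomorphism suffices, the lemma serves for [F]
    and for its quasi-inverse alike. *)
Lemma nat_iso_id_faithful (C D : Cat) (F : Functor C D) (G : Functor D C) :
  nat_iso (fcomp F G) (fid C) ->
  forall x y (f f' : hom x y), hom_map F f = hom_map F f' -> f = f'.
Proof.
case/nat_isoP=> eta [etaI etaN] x y f f' E.
have N (g : hom x y) : hom_map G (hom_map F g) ;; eta y = eta x ;; g.
  (* The images of [g] under [fcomp F G] and under [F] then [G] carry different endpoint proofs, so
     naturality is transferred through the underlying arrows. *)
  by have := etaN _ _ g => /(f_equal (@hmor _ _ _)) N; apply: hom_ext;
    etransitivity; [|etransitivity; [exact: N|]]; apply: cmp_eq.
by apply: iso_cancel_l (etaI x) _; rewrite -!N E.
Qed.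

Lemma equivalence_faithful (C D : Cat) (F : Functor C D) :
  is_equivalence F -> faithful F.
Proof.
case=> G [eta _] f f' Ed Ec E.
suff /(f_equal (@hmor _ _ _)) : mkhom f = Hom (esym Ed) (esym Ec) by [].
by apply: (nat_iso_id_faithful eta); apply: hom_ext.
Qed.

(** The preimage of [h] is the conjugate of [G h] by the unit [eta]. Naturality of [eta] then gives
    [G (F f) = G h], and [G] is faithful because of [eps]. *)
Lemma equivalence_full (C D : Cat) (F : Functor C D) :
  is_equivalence F -> full F.
Proof.
case=> G [/nat_isoP [eta [etaI etaN]] eps] x y g gd gc.
have [e [eE Ee]] := proj1 (is_iso_hom _) (etaI x).
pose h : hom (fob F x) (fob F y) := Hom gd gc.
pose f : hom x y := e ;; hom_map G h ;; eta y.
have N : hom_map G (hom_map F f) ;; eta y = eta x ;; f.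
  by have := etaN _ _ f => /(f_equal (@hmor _ _ _)) N; apply: hom_ext;
    etransitivity; [|etransitivity; [exact: N|]]; apply: cmp_eq.
exists f; split; [exact: hdom|exact: hcod|].
suff: hom_map F f = h by move/(f_equal (@hmor _ _ _)).
apply: (nat_iso_id_faithful eps).
apply: iso_cancel_r (etaI y) _; rewrite N /f.
by move: eE; rewrite !hom_assoc => ->; rewrite hom_idl.
Qed.

Section FunctorOfHom.
Variables (C D : Cat) (fo : Ob C -> Ob D).
Variable fm : forall x y, hom x y -> hom (fo x) (fo y).
Hypothesis fm_id : forall x, fm (hom_id x) = hom_id (fo x).
Hypothesis fm_comp : forall x y z (f : hom x y) (g : hom y z),
  fm (f ;; g) = fm f ;; fm g.

(** The functor under construction applies [fm] to [mkhom f], whose endpoints are literally [dom f]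
    and [cod f]. This lemma moves [fm] along propositional equalities of endpoints. *)
Lemma fm_eq x y x' y' (f : hom x y) (f' : hom x' y') :
  x = x' -> y = y' -> hmor f = hmor f' -> hmor (fm f) = hmor (fm f').
Proof. by move=> Ex Ey E; subst; rewrite (hom_ext E). Qed.

Lemma functor_of_hom_laws : functor_laws fo (fun f => hmor (fm (mkhom f))).
Proof.
split=> [f|f|x|f g H H'].
- exact: hdom.
- exact: hcod.
- transitivity (hmor (fm (hom_id x))); last by rewrite fm_id.
  by apply: fm_eq; [apply: law_dom_id (catP C) _|apply: law_cod_id (catP C) _|].
- pose f' : hom (dom f) (dom g) := Hom erefl H.
  transitivity (hmor (fm (f' ;; mkhom g))).
    apply: fm_eq; [exact: law_dom_comp (catP C) _|exact: law_cod_comp (catP C) _|].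
    exact: cmp_eq.
  by rewrite fm_comp; apply: cmp_eq; [apply: fm_eq|].
Qed.

Definition functor_of_hom : Functor C D := MkFunctor functor_of_hom_laws.

Lemma hom_map_of_hom x y (f : hom x y) : hom_map functor_of_hom f = fm f.
Proof. by apply: hom_ext; apply: fm_eq; [exact: hdom|exact: hcod|]. Qed.

End FunctorOfHom.

(** The quasi-inverse sends [d] to a chosen [go d] with an isomorphism [u d] from [d] to [F (go d)],
    and sends [g] to the unique preimage of its conjugate [v d ;; g ;; u d']. Functoriality and
    naturality of the unit are checked after applying the faithful [F]. The hypotheses only assert
    existence, so the choices come from indefinite description. *)
Lemma ff_ess_surj_equivalence (C D : Cat) (F : Functor C D) :
  full F -> faithful F -> ess_surj F -> is_equivalence F.
Proof.
move=> /full_hom fullF /faithful_hom faithF ess.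
have sel d : {c & {p : hom d (fob F c) * hom (fob F c) d |
    hom_inverse p.1 p.2}}.
  case: (constructive_indefinite_description _ (ess d)) => c.
  case/constructive_indefinite_description=> h [hI hd hc]; exists c.
  have := proj1 (is_iso_hom (Hom hd hc)) hI.
  by case/constructive_indefinite_description=> k kP; exists (Hom hd hc, k).
pose go d := projT1 (sel d).
pose u d : hom d (fob F (go d)) := (proj1_sig (projT2 (sel d))).1.
pose v d : hom (fob F (go d)) d := (proj1_sig (projT2 (sel d))).2.
have uv d : u d ;; v d = hom_id d by case: (proj2_sig (projT2 (sel d))).
have vu d : v d ;; u d = hom_id _ by case: (proj2_sig (projT2 (sel d))).
have vI d : is_iso (v d) by apply: (is_iso_inverse (conj (vu d) (uv d))).
have lift x y (g : hom (fob F x) (fob F y)) : {f | hom_map F f = g}.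
  exact: constructive_indefinite_description (fullF x y g).
pose gm d d' (g : hom d d') := proj1_sig (lift _ _ (v d ;; g ;; u d')).
have gmE d d' (g : hom d d') : hom_map F (gm _ _ g) = v d ;; g ;; u d'.
  exact: proj2_sig (lift _ _ _).
have gm_id d : gm _ _ (hom_id d) = hom_id (go d).
  by apply: faithF; rewrite gmE hom_idr vu hom_map_id.
have gm_comp d d' d'' (g : hom d d') (h : hom d' d'') :
    gm _ _ (g ;; h) = gm _ _ g ;; gm _ _ h.
  apply: faithF; rewrite hom_map_comp !gmE !hom_assoc.
  by congr (_ ;; _ ;; _); rewrite -hom_assoc uv hom_idr.
exists (functor_of_hom gm_id gm_comp); split; apply/nat_isoP.
(* The component at [x] is the lift of [v (F x)], an arrow from [go (F x)] to [x]; a lift of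
   [u (F x)] is its inverse. *)
- pose eta x := lift _ _ (v (fob F x)).
  exists (fun x => proj1_sig (eta x)); split=> [x|x y f].
  + have [w wE] := lift _ _ (u (fob F x)).
    apply: (@is_iso_inverse _ _ _ _ w); split; apply: faithF;
      by rewrite hom_map_comp wE (proj2_sig (eta x)) hom_map_id ?uv ?vu.
  + apply: faithF.
    transitivity (hom_map F (gm _ _ (hom_map F f) ;; proj1_sig (eta y))).
      congr (hom_map F _); apply: hom_ext; apply: cmp_eq => //.
      exact: (f_equal (@hmor _ _ _) (hom_map_of_hom gm_id gm_comp (hom_map F f))).
    rewrite hom_map_comp gmE (proj2_sig (eta y)) -hom_assoc uv hom_idr.
    transitivity (hom_map F (proj1_sig (eta x) ;; f)).
      by rewrite hom_map_comp (proj2_sig (eta x)).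
    by congr (hom_map F _); apply: hom_ext; apply: cmp_eq.
- exists v; split=> // d d' g.
  transitivity (hom_map F (gm _ _ g) ;; v d').
    apply: hom_ext; apply: cmp_eq => //; congr (fmor F _).
    exact: (f_equal (@hmor _ _ _) (hom_map_of_hom gm_id gm_comp g)).
  by rewrite gmE -hom_assoc uv hom_idr; apply: hom_ext; apply: cmp_eq.
Qed.

Lemma is_equivalenceP (C D : Cat) (F : Functor C D) :
  is_equivalence F <-> [/\ full F, faithful F & ess_surj F].
Proof.
split; last by case; apply: ff_ess_surj_equivalence.
by move=> eF; split; [apply: equivalence_full|apply: equivalence_faithful|
  apply: equivalence_ess_surj].
Qed.

(** * Epimorphisms for the topology *)

Lemma T_epi_tauP (E B : Cat) (p : Functor E B) :
  T_epi tau p <-> simplicially_surjective p.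
Proof.
split=> [pE|pS X g].
(* Take a cover of [B] on which the identity lifts through [p]: a string of [B] lifts to the
   covering category, and [u] carries it on to [E]. *)
- have [c [[i [_ ci]] lift]] := pE B (fid B); have [u uP] := lift i.
  move=> k y; have [x xy] := ci k y.
  exists (string_map u x); rewrite -xy; apply: string_ext => j /=.
  + exact: (f_equal (fun K => fob K (sob x j)) uP).
  + exact: (f_equal (fun K => fmor K (sar x j)) uP).
- exists (CoverFamily (fun _ : unit => pb_snd p g)); split; last first.
    by move=> i; exists (pb_fst p g); apply: functor_ext => x /=; apply: pbkP.
  apply: (@tau_covers_pullback B X (CoverFamily (fun _ : unit => p)) g).
  by exists tt; split=> //; case.
Qed.

(** * Strings of length zero and one *)

Section ShortStrings.
Variable C : Cat.

Definition string0 (x : Ob C) : string C 0 :=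
  @Str C 0 (fun=> x) (fun i => False_rect _ (notF (ltn_ord i)))
    (fun i => False_rect _ (notF (ltn_ord i)))
    (fun i => False_rect _ (notF (ltn_ord i))).

Lemma string0_ext (x y : string C 0) : sob x ord0 = sob y ord0 -> x = y.
Proof. by move=> E; apply: string_ext => i; [rewrite (ord1 i)|case: i]. Qed.

Definition ends (f : Mor C) (i : 'I_2) : Ob C :=
  if i == ord0 then dom f else cod f.

Lemma ends_dom f (i : 'I_1) : dom f = ends f (widen_ord (leqnSn 1) i).
Proof. by rewrite (ord1 i). Qed.

Lemma ends_cod f (i : 'I_1) : cod f = ends f (lift ord0 i).
Proof. by rewrite (ord1 i). Qed.

Definition string1 (f : Mor C) : string C 1 :=
  @Str C 1 (ends f) (fun=> f) (ends_dom f) (ends_cod f).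

Lemma string1_ext (x y : string C 1) : sar x ord0 = sar y ord0 -> x = y.
Proof.
move=> E; apply: string_ext => i; last by rewrite (ord1 i).
case: (unliftP ord0 i) => [j|] ->; first by rewrite -!scod (ord1 j) E.
have -> : ord0 = widen_ord (leqnSn 1) ord0 by apply: val_inj.
by rewrite -!sdom E.
Qed.

End ShortStrings.

(** * Isomorphisms in the levels of the vertical nerve *)

Section NerveEval.
Variables (B : DblCat) (k : nat).

(** Horizontal composition of strings is componentwise, so evaluation at a vertex is a functor, as
    is evaluation at an arrow below. Hence every component of an invertible string of squares is
    invertible. *)
Lemma Nv_ob_laws (i : 'I_k.+1) : functor_laws (C := Nv B k) (D := hcat B)
  (fun s : string (D0 B) k => sob s i) (fun s : string (D1 B) k => sob s i).
Proof. by split=> //= f g H H'; congr (fob (hcmp B)); apply: pbk_ext. Qed.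

Definition Nv_ob (i : 'I_k.+1) : Functor (Nv B k) (hcat B) :=
  MkFunctor (Nv_ob_laws i).

Lemma Nv_ar_laws (i : 'I_k) : functor_laws (C := Nv B k) (D := sqcat B)
  (fun s : string (D0 B) k => sar s i) (fun s : string (D1 B) k => sar s i).
Proof. by split=> //= f g H H'; congr (fmor (hcmp B)); apply: pbk_ext. Qed.

Definition Nv_ar (i : 'I_k) : Functor (Nv B k) (sqcat B) :=
  MkFunctor (Nv_ar_laws i).

Lemma Nv_iso_lift (m : Mor (Nv B k)) :
  is_iso m -> exists s, string_map (iso1_incl B) s = m.
Proof.
move=> mI.
pose o i : iso_ob B := exist _ _ (functor_iso (Nv_ob i) mI).
pose a i : iso_mor B := exist _ _ (functor_iso (Nv_ar i) mI).
have ad i : iso_dom (a i) = o (widen_ord (leqnSn k) i).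
  by apply: iso_ext; apply: (sdom (m : string (D1 B) k)).
have ac i : iso_cod (a i) = o (lift ord0 i).
  by apply: iso_ext; apply: (scod (m : string (D1 B) k)).
by exists (@Str (iso1 B) k o a ad ac); apply: string_ext.
Qed.

End NerveEval.

(** This is the body of the existential in [is_iso], kept as a relation so that chosen inverses can
    be named and compared. *)
Definition inverse (C : Cat) (f g : Mor C) : Prop :=
  exists (Hfg : cod f = dom g) (Hgf : cod g = dom f),
    cmp (Pbk Hfg) = idm (dom f) /\ cmp (Pbk Hgf) = idm (dom g).

Lemma inverse_uniq (C : Cat) (f g g' : Mor C) :
  inverse f g -> inverse f g' -> g = g'.
Proof.
case=> Hfg [Hgf [_ E]] [Hfg' [Hgf' [E' _]]].
exact: inverse_unique Hfg Hgf Hfg' Hgf' E E'.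
Qed.

Lemma inverse_map (C D : Cat) (F : Functor C D) (f g : Mor C) :
  inverse f g -> inverse (fmor F f) (fmor F g).
Proof.
have FP := functorP F; case=> [Hfg [Hgf [E1 E2]]].
have Hfg' : cod (fmor F f) = dom (fmor F g).
  by rewrite (law_cod FP) (law_dom FP) Hfg.
have Hgf' : cod (fmor F g) = dom (fmor F f).
  by rewrite (law_cod FP) (law_dom FP) Hgf.
exists Hfg', Hgf'.
by rewrite -(law_comp FP Hfg) -(law_comp FP Hgf) E1 E2 !(law_id FP)
   !(law_dom FP).
Qed.

(** Inverses are chosen separately for each vertex and each square. They fit into a string because
    the vertical source and target are functors from [sqcat B] to [hcat B], hence send the inverse
    of a square to an inverse of its boundary, and inverses are unique. *)
Lemma Nv_iso_string (B : DblCat) k (s : string (iso1 B) k) :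
  @is_iso (Nv B k) (string_map (iso1_incl B) s).
Proof.
have selo i : {g : Mor (hcat B) | inverse (proj1_sig (sob s i)) g}.
  exact: constructive_indefinite_description (proj2_sig (sob s i)).
have sela i : {b : Mor (sqcat B) | inverse (proj1_sig (sar s i)) b}.
  exact: constructive_indefinite_description (proj2_sig (sar s i)).
pose o i := proj1_sig (selo i).
pose a i : Mor (D1 B) := proj1_sig (sela i).
have ad i : dom (a i) = o (widen_ord (leqnSn k) i).
  apply: inverse_uniq (proj2_sig (selo _)).
  rewrite -sdom; exact: inverse_map (MkFunctor (vdom_laws B)) _ _ (proj2_sig (sela i)).
have ac i : cod (a i) = o (lift ord0 i).
  apply: inverse_uniq (proj2_sig (selo _)).
  rewrite -scod; exact: inverse_map (MkFunctor (vcod_laws B)) _ _ (proj2_sig (sela i)).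
pose t : Mor (Nv B k) := @Str (D1 B) k o a ad ac.
pose m : Mor (Nv B k) := string_map (iso1_incl B) s.
have mt : cod m = dom t.
  apply: string_ext => i /=.
  - by case: (proj2_sig (selo i)).
  - by case: (proj2_sig (sela i)).
have tm : cod t = dom m.
  apply: string_ext => i /=.
  - by case: (proj2_sig (selo i)) => H [].
  - by case: (proj2_sig (sela i)) => H [].
exists t, mt, tm; split; apply: string_ext => i /=.
- have [H [H' [E _]]] := proj2_sig (selo i); apply: etrans E.
  by congr (fob (hcmp B)); apply: pbk_ext.
- have [H [H' [E _]]] := proj2_sig (sela i); apply: etrans E.
  by congr (fmor (hcmp B)); apply: pbk_ext.
- have [H' [H [_ E]]] := proj2_sig (selo i); apply: etrans E.
  by congr (fob (hcmp B)); apply: pbk_ext.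
- have [H' [H [_ E]]] := proj2_sig (sela i); apply: etrans E.
  by congr (fmor (hcmp B)); apply: pbk_ext.
Qed.

(** * Fibrations and essential surjectivity *)

Section Comparison.
Variables (A B : DblCat) (K : DblFunctor A B).

(** A [k]-string of [PF0 K] is an isofibration lifting problem for [Nv_map K k]: an object [a]
    together with an isomorphism ending at the image of [a]. For a string lifted along [rF0 K], the
    first component of the equation fixes the codomain and the second fixes the image. *)
Lemma T_fibration_tauP : T_fibration K tau <-> transferred_fib K.
Proof.
rewrite /T_fibration T_epi_tauP; split=> [rS k a h hI ha|rS k y].
- have [s sh] := Nv_iso_lift hI.
  have E : string_map (F0 K) a = string_map (iso_tgt B) s.
    by rewrite -[LHS]ha -sh; apply: string_ext.
  have [x xy] := rS k (string_pair (Pbk E)).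
  exists (string_map (iso1_incl A) x); split; first exact: Nv_iso_string.
  + apply: string_ext => i /=.
    * exact: (f_equal (fun z : string (PF0 K) k => p1 (sob z i)) xy).
    * exact: (f_equal (fun z : string (PF0 K) k => p1 (sar z i)) xy).
  + rewrite -sh; apply: string_ext => i /=.
    * exact: (f_equal (fun z : string (PF0 K) k => proj1_sig (p2 (sob z i))) xy).
    * exact: (f_equal (fun z : string (PF0 K) k => proj1_sig (p2 (sar z i))) xy).
- pose a : Ob (Nv A k) := string_map (pb_fst (F0 K) (iso_tgt B)) y.
  pose s := string_map (Fbar0 K) y.
  have ha : @cod (Nv B k) (string_map (iso1_incl B) s) = fob (Nv_map K k) a.
    by apply: string_ext => i /=; symmetry; apply: pbkP.
  have [m [mI ma mh]] := rS k a _ (Nv_iso_string s) ha.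
  have [x xm] := Nv_iso_lift mI.
  exists x; apply: string_ext => i; apply: pbk_ext => /=.
  + by have := f_equal (fun z : string (D0 A) k => sob z i) ma; rewrite -xm.
  + apply: iso_ext.
    by have := f_equal (fun z : string (D1 B) k => sob z i) mh; rewrite -xm.
  + by have := f_equal (fun z : string (D0 A) k => sar z i) ma; rewrite -xm.
  + apply: iso_ext.
    by have := f_equal (fun z : string (D1 B) k => sar z i) mh; rewrite -xm.
Qed.

(** A preimage of [d] is a string of [PF0 K], that is, an object [c] with an isomorphism from [d] to
    the image of [c]. *)
Lemma T_epi_ess_surj :
  T_epi tau (fcomp (Fbar0 K) (iso_src B)) <-> forall k, ess_surj (Nv_map K k).
Proof.
rewrite T_epi_tauP; split=> [pS k d|pS k d].
- have [y <-] := pS k d.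
  exists (string_map (pb_fst (F0 K) (iso_tgt B)) y).
  exists (string_map (iso1_incl B) (string_map (Fbar0 K) y)); split.
  + exact: Nv_iso_string.
  + exact: string_ext.
  + by apply: string_ext => i /=; symmetry; apply: pbkP.
- have [c [h [hI <- hc]]] := pS k d; have [s sh] := Nv_iso_lift hI.
  have E : string_map (F0 K) c = string_map (iso_tgt B) s.
    by rewrite -[LHS]hc -sh; apply: string_ext.
  by exists (string_pair (Pbk E)); rewrite -sh; apply: string_ext.
Qed.


(** * Full faithfulness: from the pullback square to the levels of the nerve *)

Let P := pullback (pair_functor (hsrc B) (htgt B)) (prod_map (F0 K) (F0 K)).

Lemma ends_square :
  fcomp (F1 K) (pair_functor (hsrc B) (htgt B)) =
  fcomp (pair_functor (hsrc A) (htgt A)) (prod_map (F0 K) (F0 K)).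
Proof.
have [oP mP] := (dblfun_obP K, dblfun_morP K).
apply: functor_ext => x /=; congr pair.
- exact: law_dom oP x.
- exact: law_cod oP x.
- exact: law_dom mP x.
- exact: law_cod mP x.
Qed.

(** The universal property, tested on the explicit pullback [P], yields [h] from [P] to [D1 A],
    inverse to the comparison functor [l]. That [h] is a section of [l] gives fullness, and that it
    is a retraction gives faithfulness: on objects for horizontal morphisms, on arrows for
    squares. *)
Lemma fully_faithful_hcat_sqcat : fully_faithful K ->
  [/\ full (hcat_map K), faithful (hcat_map K),
      full (sqcat_map K) & faithful (sqcat_map K)].
Proof.
case=> [_ univ].
have sq : fcomp (pb_fst _ _ : Functor P _) (pair_functor (hsrc B) (htgt B)) =
          fcomp (pb_snd _ _) (prod_map (F0 K) (F0 K)).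
  by apply: functor_ext => x; exact: (pbkP x).
have [h [[h1 h2] _]] := univ _ _ _ sq.
pose l : Functor (D1 A) P := pb_lift ends_square.
(* Both [fcomp l h] and the identity factor the square [ends_square], so they agree by
   uniqueness. *)
have lh : fcomp l h = fid (D1 A).
  have [k [_ kU]] := univ _ _ _ ends_square.
  rewrite -(kU (fcomp l h)) -1?(kU (fid _)) //; split.
  - by apply: functor_ext.
  - by apply: functor_ext.
  - by apply: functor_ext => x; [have := f_equal (fun G => fob G (fob l x)) h1|
      have := f_equal (fun G => fmor G (fmor l x)) h1].
  - by apply: functor_ext => x; [have := f_equal (fun G => fob G (fob l x)) h2|
      have := f_equal (fun G => fmor G (fmor l x)) h2].
have lho x : fob h (fob l x) = x by exact: (f_equal (fun G => fob G x) lh).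
have lhm f : fmor h (fmor l f) = f by exact: (f_equal (fun G => fmor G f) lh).
split=> [x y g gd gc|f f' Ed Ec E|x y g gd gc|f f' Ed Ec E].
- have xyg : fob (pair_functor (hsrc B) (htgt B)) g =
             fob (prod_map (F0 K) (F0 K)) (x, y) by congr pair.
  pose w : Ob P := Pbk xyg; exists (fob h w).
  have /= E1 := f_equal (fun G => fob G w) h1.
  by have /= [E2 E3] := f_equal (fun G => fob G w) h2.
- rewrite -(lho f) -(lho f'); congr (fob h _); apply: pbk_ext => //=.
  by congr pair.
- have xyg : fmor (pair_functor (hsrc B) (htgt B)) g =
             fmor (prod_map (F0 K) (F0 K)) (x, y) by congr pair.
  pose w : Mor P := Pbk xyg; exists (fmor h w).
  have /= E1 := f_equal (fun G => fmor G w) h1.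
  by have /= [E2 E3] := f_equal (fun G => fmor G w) h2.
- rewrite -(lhm f) -(lhm f'); congr (fmor h _); apply: pbk_ext => //=.
  by congr pair.
Qed.

(** Fullness supplies the values of the mediating functor on objects and arrows. Functoriality and
    uniqueness are faithfulness: the two sides of each equation have the same horizontal source,
    target and image under [K]. *)
Lemma hcat_sqcat_fully_faithful :
  full (hcat_map K) -> faithful (hcat_map K) ->
  full (sqcat_map K) -> faithful (sqcat_map K) -> fully_faithful K.
Proof.
move=> fullo faitho fullm faithm; split=> [|W a b ab]; first exact: ends_square.
have abo w : (fob (hsrc B) (fob a w), fob (htgt B) (fob a w)) =
  (fob (F0 K) (fob b w).1, fob (F0 K) (fob b w).2).
  exact: (f_equal (fun G => fob G w) ab).
have abm w : (fmor (hsrc B) (fmor a w), fmor (htgt B) (fmor a w)) =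
  (fmor (F0 K) (fmor b w).1, fmor (F0 K) (fmor b w).2).
  exact: (f_equal (fun G => fmor G w) ab).
have selo w : {x : Ob (D1 A) | [/\ fob (hsrc A) x = (fob b w).1,
    fob (htgt A) x = (fob b w).2 & fob (F1 K) x = fob a w]}.
  apply: constructive_indefinite_description; case: (abo w) => E1 E2.
  exact: fullo E1 E2.
have selm w : {x : Mor (D1 A) | [/\ fmor (hsrc A) x = (fmor b w).1,
    fmor (htgt A) x = (fmor b w).2 & fmor (F1 K) x = fmor a w]}.
  apply: constructive_indefinite_description; case: (abm w) => E1 E2.
  exact: fullm E1 E2.
pose ho w := proj1_sig (selo w); pose hm w := proj1_sig (selm w).
have hos w : fob (hsrc A) (ho w) = (fob b w).1 by case: (proj2_sig (selo w)).
have hot w : fob (htgt A) (ho w) = (fob b w).2 by case: (proj2_sig (selo w)).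
have hoF w : fob (F1 K) (ho w) = fob a w by case: (proj2_sig (selo w)).
have hms w : fmor (hsrc A) (hm w) = (fmor b w).1 by case: (proj2_sig (selm w)).
have hmt w : fmor (htgt A) (hm w) = (fmor b w).2 by case: (proj2_sig (selm w)).
have hmF w : fmor (F1 K) (hm w) = fmor a w by case: (proj2_sig (selm w)).
have [aP bP] := (functorP a, functorP b).
have [sP [tP KP]] := (functorP (hsrc A), (functorP (htgt A), functorP (F1 K))).
have hP : functor_laws ho hm.
  (* The domain and codomain laws compare horizontal morphisms, whence [faitho]; the identity and
     composition laws compare squares, whence [faithm]. *)
  split=> [f|f|x|f g H H'].
  - apply: faitho => /=.
    + by rewrite -(law_dom sP) hms hos -(law_dom bP).
    + by rewrite -(law_dom tP) hmt hot -(law_dom bP).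
    + by rewrite -(law_dom KP) hmF hoF (law_dom aP).
  - apply: faitho => /=.
    + by rewrite -(law_cod sP) hms hos -(law_cod bP).
    + by rewrite -(law_cod tP) hmt hot -(law_cod bP).
    + by rewrite -(law_cod KP) hmF hoF (law_cod aP).
  - apply: faithm => /=.
    + by rewrite (law_id sP) hms hos (law_id bP).
    + by rewrite (law_id tP) hmt hot (law_id bP).
    + by rewrite (law_id KP) hmF hoF (law_id aP).
  - have Hb : cod (fmor b f) = dom (fmor b g).
      by rewrite (law_cod bP) (law_dom bP) H.
    have Ha : cod (fmor a f) = dom (fmor a g).
      by rewrite (law_cod aP) (law_dom aP) H.
    apply: faithm => /=.
    + rewrite hms (law_comp bP H Hb) /= (law_comp sP).
        by rewrite (law_cod sP) (law_dom sP) H'.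
      by move=> H''; apply: cmp_eq; rewrite hms.
    + rewrite hmt (law_comp bP H Hb) /= (law_comp tP).
        by rewrite (law_cod tP) (law_dom tP) H'.
      by move=> H''; apply: cmp_eq; rewrite hmt.
    + rewrite hmF (law_comp aP H Ha) /= (law_comp KP).
        by rewrite (law_cod KP) (law_dom KP) H'.
      by move=> H''; apply: cmp_eq; rewrite hmF.
exists (MkFunctor hP); split; first split.
- exact: functor_ext.
- by apply: functor_ext => x /=; rewrite ?hos ?hot ?hms ?hmt -surjective_pairing.
- move=> h [hF hb]; apply: functor_ext => x /=.
  + have /= E1 := f_equal (fun G : Functor W (prodC _ _) => (fob G x).1) hb.
    have /= E2 := f_equal (fun G : Functor W (prodC _ _) => (fob G x).2) hb.
    have /= E3 := f_equal (fun G => fob G x) hF.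
    by apply: faitho; rewrite /= ?hos ?hot ?hoF ?E3 ?E1 ?E2.
  + have /= E1 := f_equal (fun G : Functor W (prodC _ _) => (fmor G x).1) hb.
    have /= E2 := f_equal (fun G : Functor W (prodC _ _) => (fmor G x).2) hb.
    have /= E3 := f_equal (fun G => fmor G x) hF.
    by apply: faithm; rewrite /= ?hms ?hmt ?hmF ?E3 ?E1 ?E2.
Qed.

(** From left to right the components are treated separately, and only the assembly of lifts into a
    string needs an argument. Conversely, level 0 gives the statements on horizontal morphisms and
    level 1 those on squares. *)
Lemma full_faithful_Nv :
  [/\ full (hcat_map K), faithful (hcat_map K),
      full (sqcat_map K) & faithful (sqcat_map K)] <->
  forall k, full (Nv_map K k) /\ faithful (Nv_map K k).
Proof.
split=> [[fullo faitho fullm faithm] k|ffN].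
- have faithN : faithful (Nv_map K k).
    move=> f f' Ed Ec E; apply: string_ext => i.
    + by apply: faitho;
        [exact: (f_equal (fun s : string (D0 A) k => sob s i) Ed)
        |exact: (f_equal (fun s : string (D0 A) k => sob s i) Ec)
        |exact: (f_equal (fun s : string (D1 B) k => sob s i) E)].
    + by apply: faithm;
        [exact: (f_equal (fun s : string (D0 A) k => sar s i) Ed)
        |exact: (f_equal (fun s : string (D0 A) k => sar s i) Ec)
        |exact: (f_equal (fun s : string (D1 B) k => sar s i) E)].
  split=> // x y g gd gc.
  have selo i : {f : Mor (hcat A) | [/\ dom f = sob x i, cod f = sob y i &
      fmor (hcat_map K) f = sob g i]}.
    apply: constructive_indefinite_description; apply: fullo.
    + exact: (f_equal (fun s : string (D0 B) k => sob s i) gd).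
    + exact: (f_equal (fun s : string (D0 B) k => sob s i) gc).
  have sela i : {f : Mor (sqcat A) | [/\ dom f = sar x i, cod f = sar y i &
      fmor (sqcat_map K) f = sar g i]}.
    apply: constructive_indefinite_description; apply: fullm.
    + exact: (f_equal (fun s : string (D0 B) k => sar s i) gd).
    + exact: (f_equal (fun s : string (D0 B) k => sar s i) gc).
  pose o i : Ob (D1 A) := proj1_sig (selo i).
  pose a i : Mor (D1 A) := proj1_sig (sela i).
  have [sP [tP KP]] := (functorP (hsrc A), (functorP (htgt A), functorP (F1 K))).
  (* The vertical source of the lifted square and the separately lifted horizontal morphism have the
     same ends and the same image under [K], so faithfulness identifies them; likewise for the
     target. *)
  have ad i : dom (a i) = o (widen_ord (leqnSn k) i).
    have [/= os ot oF] := proj2_sig (selo (widen_ord (leqnSn k) i)).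
    have [/= as_ at_ aF] := proj2_sig (sela i).
    apply: faitho; rewrite /= -?(law_dom sP) -?(law_dom tP) -?(law_dom KP).
    + by rewrite os as_ sdom.
    + by rewrite ot at_ sdom.
    + by rewrite oF aF sdom.
  have ac i : cod (a i) = o (lift ord0 i).
    have [/= os ot oF] := proj2_sig (selo (lift ord0 i)).
    have [/= as_ at_ aF] := proj2_sig (sela i).
    apply: faitho; rewrite /= -?(law_cod sP) -?(law_cod tP) -?(law_cod KP).
    + by rewrite os as_ scod.
    + by rewrite ot at_ scod.
    + by rewrite oF aF scod.
  exists (@Str (D1 A) k o a ad ac); split; apply: string_ext => i /=.
  - by case: (proj2_sig (selo i)).
  - by case: (proj2_sig (sela i)).
  - by case: (proj2_sig (selo i)).
  - by case: (proj2_sig (sela i)).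
  - by case: (proj2_sig (selo i)).
  - by case: (proj2_sig (sela i)).
- have [[full0 faith0] [full1 faith1]] := (ffN 0, ffN 1).
  split=> [x y g gd gc|f f' Ed Ec E|x y g gd gc|f f' Ed Ec E].
  + have [||f [fd fc fg]] := full0 (@string0 (D0 A) x) (@string0 (D0 A) y)
      (@string0 (D1 B) g).
    * exact: string0_ext.
    * exact: string0_ext.
    exists (sob (f : string (D1 A) 0) ord0); split.
    * exact: (f_equal (fun s : string (D0 A) 0 => sob s ord0) fd).
    * exact: (f_equal (fun s : string (D0 A) 0 => sob s ord0) fc).
    * exact: (f_equal (fun s : string (D1 B) 0 => sob s ord0) fg).
  + have : @string0 (D1 A) f = @string0 (D1 A) f' by apply: faith0; apply: string0_ext.
    exact: (f_equal (fun s : string (D1 A) 0 => sob s ord0)).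
  + have [||f [fd fc fg]] := full1 (@string1 (D0 A) x) (@string1 (D0 A) y)
      (@string1 (D1 B) g).
    * exact: string1_ext.
    * exact: string1_ext.
    exists (sar (f : string (D1 A) 1) ord0); split.
    * exact: (f_equal (fun s : string (D0 A) 1 => sar s ord0) fd).
    * exact: (f_equal (fun s : string (D0 A) 1 => sar s ord0) fc).
    * exact: (f_equal (fun s : string (D1 B) 1 => sar s ord0) fg).
  + have : @string1 (D1 A) f = @string1 (D1 A) f' by apply: faith1; apply: string1_ext.
    exact: (f_equal (fun s : string (D1 A) 1 => sar s ord0)).
Qed.

(** * Weak equivalences and the coincidence of the two structures *)

Lemma T_equivalence_tauP : T_equivalence K tau <-> transferred_weq K.
Proof.
split.
- case=> /T_epi_ess_surj ess /fully_faithful_hcat_sqcat/full_faithful_Nv ff k.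
  by apply/is_equivalenceP; have [? ?] := ff k.
- move=> eK; split.
    by apply/T_epi_ess_surj => k; case/is_equivalenceP: (eK k).
  have [? ? ? ?] := proj2 full_faithful_Nv (fun k =>
    let: And3 a b _ := proj1 (is_equivalenceP _) (eK k) in conj a b).
  exact: hcat_sqcat_fully_faithful.
Qed.

End Comparison.

Theorem corollary8p29 (A B : DblCat) (K : DblFunctor A B) :
  (weq (topology_model tau) K <-> weq transferred_model K) /\
  (fib (topology_model tau) K <-> fib transferred_model K) /\
  (cof (topology_model tau) K <-> cof transferred_model K).
Proof.
split; first exact: T_equivalence_tauP.
split; first exact: T_fibration_tauP.
(* Both classes of cofibrations are defined by lifting against the trivial fibrations, which agree
   by the two preceding equivalences. *)
by split=> llp C D p pF pW; apply: llp;
  [apply/T_fibration_tauP|apply/T_equivalence_tauP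
  |apply/T_fibration_tauP|apply/T_equivalence_tauP].
Qed.
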